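(* Let $t\ge1$ be an integer and let $G=(V,E)$ be a graph on $n$ vertices with adjacency matrix $A$ and adjacency eigenvalues $\lambda_1\ge\lambda_2\ge\cdots\ge\lambda_n$ (with multiplicity). Let $p\in\mathbb{R}_t[x]$, and put $W(p):=\max_{u\in V}\{(p(A))_{uu}\}$ and $w(p):=\min_{u\in V}\{(p(A))_{uu}\}$. Then $$\mathrm{eq}_{t+1}(G)\le \min\bigl\{\,|\{i: p(\lambda_i)\ge w(p)\}|,\ |\{i: p(\lambda_i)\le W(p)\}|\,\bigr\}.$$
   Context: Graphs are finite, simple and undirected; $d(u,v)$ is the shortest-path distance. $\mathbb{R}_t[x]$ is the set of real polynomials of degree at most $t$. A set $S\subseteq V$ is $s$-equidistant if $d(u,v)=s$ for all distinct $u,v\in S$, and $\mathrm{eq}_s(G)$ is the maximum size of an $s$-equidistant set of $G$. *)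

(* Defs.v *)
From HB Require Import structures.
From mathcomp Require Import all_boot all_order all_algebra.
From mathcomp Require Import reals.

Set Implicit Arguments.
Unset Strict Implicit.
Unset Printing Implicit Defensive.

Import Order.TTheory GRing.Theory Num.Theory.

(* A simple graph is a symmetric irreflexive relation [e] on a finite type;   *)
(* the two properties are hypotheses of the statements that use [e].          *)
Section GraphDistance.

Variables (V : finType) (e : rel V).

Definition has_path (u v : V) (k : nat) : bool :=
  [exists p : k.-tuple V,
     [&& path e u p, last u p == v & uniq (u :: p)]].

(* [None] is the infinite distance between vertices of different components.  *)
(* The range of lengths is exhaustive, since a path has at most #|V| vertices *)
(* and so at most #|V| - 1 edges.                                             *)
Definition gdist (u v : V) : option nat :=
  ohead [seq k <- iota 0 #|V| | has_path u v k].

Definition equidistant (s : nat) (S : {set V}) : bool :=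
  [forall u in S, forall v in S, (u != v) ==> (gdist u v == Some s)].

(* The empty set is equidistant, so this is the maximum of a nonempty family. *)
Definition eq_number (s : nat) : nat :=
  \max_(S : {set V} | equidistant s S) #|S|.

End GraphDistance.

Local Open Scope ring_scope.

Definition adjacency_mx (R : nzRingType) (n : nat) (e : rel 'I_n) : 'M[R]_n :=
  \matrix_(u, v) (e u v)%:R.

Definition is_spectrum (R : realType) (n : nat) (A : 'M[R]_n)
    (lam : n.-tuple R) : Prop :=
  sorted >=%R lam /\ char_poly A = \prod_(i < n) ('X - (tnth lam i)%:P).

(* [A ord0 ord0] is itself one of the diagonal entries, so using it as the    *)
(* default value leaves the maximum and the minimum unchanged.                *)
Definition max_diag (R : realType) (n : nat) (A : 'M[R]_n.+1) : R :=
  \big[Num.max/A ord0 ord0]_(u < n.+1) A u u.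

Definition min_diag (R : realType) (n : nat) (A : 'M[R]_n.+1) : R :=
  \big[Num.min/A ord0 ord0]_(u < n.+1) A u u.

(* Main.v *)
(* Let S be (t+1)-equidistant. Since p has degree at most t, the submatrix of *)
(* p(A) indexed by S is diagonal, so for q = p - w(p) and q = W(p) - p the    *)
(* quadratic form of q(A) is nonnegative on the coordinate subspace R^S. It   *)
(* is negative definite on the span of the eigenvectors with q(lambda_i) < 0, *)
(* so the two subspaces meet only in 0, whence |S| <= |{i: q(lambda_i) >= 0}|.*)
Require Import Defs.
From HB Require Import structures.
From mathcomp Require Import all_boot all_order all_algebra.
From mathcomp Require Import spectral sesquilinear complex.
From mathcomp Require Import reals.

Set Implicit Arguments.
Unset Strict Implicit.
Unset Printing Implicit Defensive.

Import Order.TTheory GRing.Theory Num.Theory.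
Local Open Scope ring_scope.

(** Two halves meet in [equidistant_card_le]. The combinatorial one, [horner_adjacency_gdist], turns
    distance into vanishing entries of q(A), since a nonzero entry of a power of A yields a walk.
    The linear-algebraic one, [card_le_nonneg_spectrum], is the dimension count;
    [card_le_nonneg_poly] transfers it to real symmetric matrices. *)

Lemma gdist_walk (V : finType) (e : rel V) (u : V) (s : seq V) :
  path e u s -> exists2 k, gdist e u (last u s) = Some k & (k <= size s)%N.
Proof.
(* Cutting out the loops of the walk leaves a path with at most #|V| - 1 edges, so its length lies
   in the range that [gdist] searches. *)
move=> es; case: (shortenP es) => r er ur rs.
have le_rs : (size r <= size s)%N.
  by apply: uniq_leq_size => //; case/andP: ur.
have rV : (size r < #|V|)%N.
  by have := max_card (mem (u :: r)); rewrite (card_uniqP ur).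
have rin : size r \in [seq k <- iota 0 #|V| | has_path e u (last u r) k].
  rewrite mem_filter mem_iota /= rV andbT /has_path.
  by apply/existsP; exists (in_tuple r); rewrite er eqxx ur.
(* The list of realised lengths is increasing, so its head is the least of them. *)
have : sorted leq [seq k <- iota 0 #|V| | has_path e u (last u r) k].
  by rewrite sorted_filter ?iota_sorted //; exact: leq_trans.
rewrite /gdist; case: filter rin => //= k l; rewrite inE => rkl kl.
exists k => //; apply: leq_trans le_rs.
case/predU1P: rkl => [->//|rl]; have := order_path_min leq_trans kl.
by move/allP => /(_ _ rl).
Qed.

(** A nonzero sum has a nonzero summand, which supplies the first edge. No walks are counted, so the
    characteristic of [R] is irrelevant. *)
Lemma adjacency_exp_walk (R : nzRingType) n (e : rel 'I_n.+1) k u v :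
  (adjacency_mx R e ^+ k) u v != 0 ->
  exists s, [/\ path e u s, last u s = v & size s = k].
Proof.
elim: k u => [|k IHk] u.
  rewrite expr0 mxE; case: (u =P v) => [<- _|]; last by rewrite eqxx.
  by exists [::].
rewrite exprS mxE => nz.
have [w wnz] :
    exists w, adjacency_mx R e u w * (adjacency_mx R e ^+ k) w v != 0.
  apply/existsP; apply: contraNT nz => /existsPn z.
  by rewrite big1 // => w _; apply/eqP; have := z w; rewrite negbK.
have euw : e u w.
  by apply: contraNT wnz => /negbTE euw; rewrite mxE euw mul0r.
have /IHk[s [es <- <-]] : (adjacency_mx R e ^+ k) w v != 0.
  by apply: contraNneq wnz => ->; rewrite mulr0.
by exists (w :: s); split => //=; rewrite euw.
Qed.

(** As [size p] is the degree plus one, only powers below [k] occur; a nonzero entry in one of them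
    would give a walk shorter than the distance. *)
Lemma horner_adjacency_gdist (R : comNzRingType) n (e : rel 'I_n.+1) k u v
    (p : {poly R}) :
  gdist e u v = Some k -> (size p <= k)%N ->
  horner_mx (adjacency_mx R e) p u v = 0.
Proof.
move=> duv lepk; rewrite -[p]coefK poly_def rmorph_sum summxE big1 // => i _.
rewrite /= horner_mxZ rmorphXn /= horner_mx_X mxE.
have [->|/adjacency_exp_walk[s [es lasts sz]]] :=
  eqVneq ((adjacency_mx R e ^+ i) u v) 0; first by rewrite mulr0.
have [j] := gdist_walk es; rewrite lasts duv sz => -[<-] le_ki.
by have := leq_trans (ltn_ord i) (leq_trans lepk le_ki); rewrite ltnn.
Qed.

Local Open Scope sesquilinear_scope.

(** Diagonality is asked only on the support of [x], so that the lemma covers both a diagonal matrix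
    and one that is diagonal on the block of [S]. *)
Lemma diag_form (C : numClosedFieldType) n (M : 'M[C]_n) (x : 'rV[C]_n) :
  (forall u v, u != v -> x 0 u != 0 -> x 0 v != 0 -> M u v = 0) ->
  (x *m M *m x^t*) 0 0 = \sum_u M u u * `|x 0 u| ^+ 2.
Proof.
move=> Mdiag; rewrite mxE; apply: eq_bigr => v _; rewrite !mxE.
have [->|xv0] := eqVneq (x 0 v) 0; first by rewrite conjC0 normr0 expr0n !mulr0.
rewrite (bigD1 v) //= big1 ?addr0 => [|u uv].
  by rewrite mulrAC -normCK mulrC.
by have [->|xu0] := eqVneq (x 0 u) 0; rewrite ?mul0r ?(Mdiag _ _ uv) ?mulr0.
Qed.

(** Vectors supported on [S] form a space of dimension #|S|, and the conditions at [T] are only #|T|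
    linear equations. *)
Lemma rowsub_kernel (F : fieldType) n (Q : 'M[F]_n) (S T : {set 'I_n}) :
  (#|T| < #|S|)%N ->
  exists x : 'rV[F]_n, [/\ x != 0, forall u, u \notin S -> x 0 u = 0 &
    forall i, i \in T -> (x *m Q) 0 i = 0].
Proof.
move=> ltTS.
pose B : 'M[F]_(#|S|, #|T|) := mxsub enum_val enum_val Q.
have /rowV0Pn[z zB z0] : kermx B != 0.
  rewrite -mxrank_eq0 mxrank_ker -lt0n subn_gt0.
  exact: leq_ltn_trans (rank_leq_col _) ltTS.
(* Right multiplication by [E] extends a vector indexed by [S] by zero. *)
pose E : 'M[F]_(#|S|, n) := rowsub enum_val 1%:M.
have xE a : (z *m E) 0 (enum_val a) = z 0 a.
  rewrite mxE (bigD1 a) //= !mxE eqxx mulr1 big1 ?addr0 // => b ba.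
  by rewrite !mxE (inj_eq enum_val_inj) (negbTE ba) mulr0.
exists (z *m E); split.
- apply: contraNneq z0 => zE; apply/eqP/rowP => a.
  by rewrite -xE zE !mxE.
- move=> u uS; rewrite mxE big1 // => a _; rewrite !mxE.
  case: eqP => [uE|_]; last by rewrite mulr0.
  by rewrite -uE enum_valP in uS.
- move=> i iT; move/sub_kermxP: zB => /rowP/(_ (enum_rank_in iT i)).
  rewrite -mulmxA /E mul_rowsub_mx mul1mx !mxE => zB; rewrite -[RHS]zB.
  by apply: eq_bigr => a _; rewrite !mxE enum_rankK_in.
Qed.

(** Otherwise some nonzero [x] supported on [S] has coordinates [y] in the eigenbasis that vanish
    wherever [d] is nonnegative. Its form is then nonnegative in terms of [x] and nonpositive in
    terms of [y], hence zero; this forces [y] = 0, and [x] = 0 as [P] is unitary. *)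
Lemma card_le_nonneg_spectrum (C : numClosedFieldType) n (P : 'M[C]_n)
    (d : 'rV[C]_n) (S : {set 'I_n}) :
  P \is unitarymx -> d \is a mxOver Num.real ->
  let M := P^t* *m diag_mx d *m P in
  {in S &, forall u v, u != v -> M u v = 0} ->
  {in S, forall u, 0 <= M u u} ->
  (#|S| <= #|[set i | (0 <= d ord0 i)%R]|)%N.
Proof.
move=> Pu dr M Mdiag Mge0; rewrite leqNgt; apply/negP.
case/(rowsub_kernel (P^t*)) => x [x0 xS xT].
have inS u : x 0 u != 0 -> u \in S by apply: contraNT => /xS->.
pose y := x *m P^t*.
have : (y *m diag_mx d *m y^t*) 0 0 = (x *m M *m x^t*) 0 0.
  by rewrite /y /M trmx_mul map_mxM -/(_^t*) trmxCK !mulmxA.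
rewrite !diag_form; first last.
- by move=> u v uv _ _; rewrite mxE (negbTE uv) mulr0n.
- by move=> u v uv /inS uS /inS vS; exact: Mdiag.
move=> eq_form.
have term_ge0 i : 0 <= - (diag_mx d i i * `|y 0 i| ^+ 2).
  rewrite oppr_ge0 mxE eqxx mulr1n; have [di|di] := boolP (0 <= d 0 i).
    by rewrite /y xT ?inE // normr0 expr0n mulr0.
  rewrite mulr_le0_ge0 ?exprn_ge0 ?normr_ge0 // ltW //.
  (* The order on [C] is partial: the failure of 0 <= d_i means d_i < 0 because d_i is real. *)
  by rewrite real_ltNge ?real0 //; exact: (mxOverP dr).
have sum0 : \sum_i - (diag_mx d i i * `|y 0 i| ^+ 2) = 0.
  apply: le_anti; rewrite sumr_ge0 // andbT sumrN eq_form oppr_le0.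
  apply: sumr_ge0 => u _; have [->|/inS uS] := eqVneq (x 0 u) 0.
    by rewrite normr0 expr0n mulr0.
  by rewrite mulr_ge0 ?Mge0 ?exprn_ge0.
have y0 : y = 0.
  apply/rowP => i; rewrite [RHS]mxE.
  have [di|di] := boolP (0 <= d 0 i); first by rewrite /y xT ?inE.
  have /eqP := psumr_eq0P (fun j _ => term_ge0 j) sum0 (i := i) isT.
  rewrite oppr_eq0 mxE eqxx mulr1n mulf_eq0 expf_eq0 normr_eq0 /=.
  by case/orP => /eqP // d0; rewrite d0 lexx in di.
by case/eqP: x0; rewrite -(mulmxKtV x Pu erefl) -/y y0 mul0mx.
Qed.

Lemma char_poly_uconj (R : comUnitRingType) n (V D : 'M[R]_n) :
  V \in unitmx -> char_poly (invmx V *m D *m V) = char_poly D.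
Proof.
move=> Vu.
have -> : char_poly (invmx V *m D *m V) =
          \det (map_mx polyC (invmx V) *m char_poly_mx D *m map_mx polyC V).
  congr (\det _); rewrite /char_poly_mx mulmxBr mulmxBl -!map_mxM.
  rewrite scalar_mxC -[_%:M *m _ *m _]mulmxA -map_mxM mulVmx //.
  by rewrite map_mx1 mulmx1.
rewrite !det_mulmx mulrAC -det_mulmx -map_mxM mulVmx //.
by rewrite map_mx1 det1 mul1r.
Qed.

(** Serves to count eigenvalues independently of the order in which they are listed. *)
Lemma card_set_perm_eq (I : finType) (T : eqType) (a : pred T) (g h : I -> T) :
  perm_eq [seq g i | i <- enum I] [seq h i | i <- enum I] ->
  #|[set i | a (g i)]| = #|[set i | a (h i)]|.
Proof.
move=> /permP/(_ a); rewrite (count_map g) (count_map h) => gh.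
by rewrite !cardsE !cardE !size_filter -enumT.
Qed.

(* The spectral theorem is only available over algebraically closed fields,   *)
(* hence the detour through R[i].                                             *)
Lemma card_le_nonneg_poly (R : rcfType) n (A : 'M[R]_n.+1)
    (lam : n.+1.-tuple R) (q : {poly R}) (S : {set 'I_n.+1}) :
  A^T = A -> char_poly A = \prod_i ('X - (tnth lam i)%:P) ->
  {in S &, forall u v, u != v -> horner_mx A q u v = 0} ->
  {in S, forall u, 0 <= horner_mx A q u u} ->
  (#|S| <= #|[set i | (0 <= q.[tnth lam i])%R]|)%N.
Proof.
move=> Asym charA Mdiag Mge0; pose f := real_complex R.
pose B := map_mx f A.
have Bherm : B \is hermsymmx.
  apply: realsym_hermsym.
    apply/is_hermitianmxP; rewrite expr0 scale1r map_mx_id //.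
    by rewrite /B map_trmx Asym.
  by apply/mxOverP => i j; rewrite mxE; apply/complex_realP; exists (A i j).
pose P := spectralmx B; pose d := spectral_diag B.
have Pu : P \in unitmx := spectral_unit _.
have BE : B = invmx P *m diag_mx d *m P.
  exact/orthomx_spectralP/hermitian_normalmx.
(* The diagonal from the spectral theorem comes in its own order; both lists are the roots of the
   same split characteristic polynomial. *)
have d_lam :
    perm_eq [seq d 0 i | i <- enum 'I_n.+1] [seq f (tnth lam i) | i <- enum 'I_n.+1].
  apply: prod_XsubC_eq; rewrite [LHS]big_map [RHS]big_map !big_enum /=.
  transitivity (char_poly B).
    rewrite BE char_poly_uconj // char_poly_trig.
      by apply: eq_bigr => i _; rewrite mxE eqxx mulr1n.
    exact/diag_mx_is_trig.
  rewrite -map_char_poly charA rmorph_prod.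
  by apply: eq_bigr => i _; rewrite /= map_polyXsubC.
have qd_real : map_mx (horner (map_poly f q)) d \is a mxOver Num.real.
  apply/mxOverP => i j; rewrite ord1 mxE.
  have /mxOverP/(_ 0 j)/complex_realP[x ->] :=
    hermitian_spectral_diag_real Bherm.
  by apply/complex_realP; exists q.[x]; rewrite horner_map.
have qBE : map_mx f (horner_mx A q) =
    P^t* *m diag_mx (map_mx (horner (map_poly f q)) d) *m P.
  rewrite map_horner_mx -/B BE horner_mx_uconjC // horner_mx_diag.
  by rewrite invmx_unitary // spectral_unitarymx.
have := card_le_nonneg_spectrum (spectral_unitarymx B) qd_real.
rewrite -/P -qBE => /(_ S) le_card.
apply: leq_trans (le_card _ _) _.
- by move=> u v uS vS uv; rewrite mxE Mdiag // rmorph0.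
- by move=> u uS; rewrite mxE ler0c Mge0.
have card_d_lam := card_set_perm_eq (fun z => 0 <= (map_poly f q).[z]) d_lam.
have -> : [set i | 0 <= (map_mx (horner (map_poly f q)) d) 0 i] =
    [set i | 0 <= (map_poly f q).[d 0 i]] by apply/setP => i; rewrite !inE mxE.
rewrite card_d_lam; apply/subset_leq_card/subsetP => i.
by rewrite !inE horner_map ler0c.
Qed.

Lemma adjacency_mx_sym (R : nzRingType) n (e : rel 'I_n) :
  symmetric e -> (adjacency_mx R e)^T = adjacency_mx R e.
Proof. by move=> syme; apply/matrixP => u v; rewrite !mxE syme. Qed.

(** Here [t] stands for t+1 of the theorem, so [size q <= t] says that the degree of [q] is below
    the common distance. *)
Lemma equidistant_card_le (R : realType) t n (e : rel 'I_n.+1)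
    (lam : n.+1.-tuple R) (q : {poly R}) (S : {set 'I_n.+1}) :
  symmetric e -> is_spectrum (adjacency_mx R e) lam -> (size q <= t)%N ->
  equidistant e t S ->
  (forall u, 0 <= horner_mx (adjacency_mx R e) q u u) ->
  (#|S| <= #|[set i | (0 <= q.[tnth lam i])%R]|)%N.
Proof.
move=> syme [_ charA] szq eqS q_ge0.
apply: (card_le_nonneg_poly (adjacency_mx_sym R syme) charA) => //.
move=> u v uS vS uv; apply: (horner_adjacency_gdist _ szq).
by move: eqS => /'forall_in_'forall_in_implyP/(_ u uS v vS uv)/eqP.
Qed.

Theorem proposition15 (R : realType) (t n : nat) (e : rel 'I_n.+1)
    (lam : n.+1.-tuple R) (p : {poly R}) :
  (1 <= t)%N ->
  symmetric e -> irreflexive e ->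
  is_spectrum (adjacency_mx R e) lam ->
  (size p <= t.+1)%N ->
  let pA := horner_mx (adjacency_mx R e) p in
  (eq_number e t.+1 <=
     minn #|[set i : 'I_n.+1 | (min_diag pA <= p.[tnth lam i])%R]|
          #|[set i : 'I_n.+1 | (p.[tnth lam i] <= max_diag pA)%R]|)%N.
Proof.
move=> _ syme _ spec szp; cbv zeta; set pA := horner_mx _ p.
apply/bigmax_leqP => S eqS.
have szC (c : R) : (size (- c%:P : {poly R}) <= t.+1)%N.
  by rewrite size_polyN (leq_trans (size_polyC_leq1 _)).
rewrite leq_min; apply/andP; split.
  (* First bound: q = p - w(p), whose value at A has nonnegative diagonal by minimality of w(p). *)
  have szq : (size (p - (min_diag pA)%:P)%R <= t.+1)%N.
    by rewrite (leq_trans (size_polyD _ _)) // geq_max szp szC.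
  have /(_ _)/leq_trans := equidistant_card_le syme spec szq eqS; apply.
    move=> u; rewrite rmorphB /= horner_mx_C !mxE eqxx mulr1n subr_ge0.
    exact: bigmin_le.
  by apply/subset_leq_card/subsetP => i; rewrite !inE !hornerE subr_ge0.
(* Second bound: q = W(p) - p, with the sign reversed so that the diagonal is again nonnegative. *)
have szq : (size ((max_diag pA)%:P - p)%R <= t.+1)%N.
  by rewrite -opprB size_polyN (leq_trans (size_polyD _ _)) // geq_max szp szC.
have /(_ _)/leq_trans := equidistant_card_le syme spec szq eqS; apply.
  move=> u; rewrite rmorphB /= horner_mx_C !mxE eqxx mulr1n subr_ge0.
  exact: (le_bigmax _ (fun u => pA u u)).
by apply/subset_leq_card/subsetP => i; rewrite !inE !hornerE subr_ge0.
Qed.
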